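(* Let $b>1$ be an odd integer. The infinite smooth words over $\{1,b\}$ that are also infinite Lyndon words are exactly $m_{\{1<b\}}$ and $\Delta^{-1}_1(m_{\{1<b\}})$.
   Context: Words are compared lexicographically with $1<b$. For a word $w$ over $\{1,b\}$ written as maximal blocks $\alpha_0^{i_0}\alpha_1^{i_1}\cdots$ ($\alpha_{k+1}\ne\alpha_k$, $i_k\ge1$), $\Delta(w)=i_0i_1\cdots$. An infinite word $w\in\{1,b\}^\omega$ is smooth if $\Delta^k(w)\in\{1,b\}^\omega$ for all $k\ge0$. $m_{\{1<b\}}$ is the lexicographically minimal infinite smooth word over $\{1,b\}$. For a word $u$ over positive integers, $\Delta^{-1}_1(u)=1^{u[0]}b^{u[1]}1^{u[2]}b^{u[3]}\cdots$. An infinite Lyndon word is an infinite word strictly smaller than each of its proper suffixes. *)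

(* Defs.v *)
From mathcomp Require Import all_boot zify.
From Stdlib Require Import ClassicalEpsilon.

Set Implicit Arguments.
Unset Strict Implicit.
Unset Printing Implicit Defensive.

Definition word := nat -> nat.

(* u \in {1, b}^omega *)
Definition over (b : nat) (u : word) : Prop := forall i, u i = 1 \/ u i = b.

(* Lexicographic order of infinite words; for words over {1, b} with b > 1,
   the order of nat on letters is the order 1 < b. *)
Definition lexlt (u v : word) : Prop :=
  exists n, (forall i, i < n -> u i = v i) /\ u n < v n.

Definition lexle (u v : word) : Prop := u =1 v \/ lexlt u v.

Definition suffix_at (k : nat) (w : word) : word := fun i => w (k + i).

Definition lyndon (w : word) : Prop := forall k, 0 < k -> lexlt w (suffix_at k w).

(* Start position of the block number k, when the block lengths are given by u *)
Definition bstart (u : word) (k : nat) : nat := \sum_(j < k) u j.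

(* Delta is a partial operation on infinite words, given here by its graph:
   [is_Delta w u] means that w = alpha_0^(u 0) alpha_1^(u 1) ... is the
   decomposition of w in maximal blocks. An eventually constant w has no such u
   (its Delta is not an infinite word). See [is_Delta_fun] for the uniqueness
   of u. *)
Definition is_Delta (w u : word) : Prop :=
  exists alpha : nat -> nat, forall k,
    [/\ 0 < u k, alpha k.+1 <> alpha k &
        forall i, bstart u k <= i < bstart u k.+1 -> w i = alpha k].

(* [is_Delta_iter k w u] : Delta^k(w) is defined and equal to u *)
Fixpoint is_Delta_iter (k : nat) (w u : word) : Prop :=
  if k is k'.+1 then exists v, is_Delta w v /\ is_Delta_iter k' v u else w =1 u.

Definition smooth (b : nat) (w : word) : Prop :=
  forall k, exists u, is_Delta_iter k w u /\ over b u.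

Definition is_min_smooth (b : nat) (m : word) : Prop :=
  smooth b m /\ forall w, smooth b w -> lexle m w.

(* The lexicographically minimal infinite smooth word over {1, b}. That it
   exists for b > 1 is [min_smoothP]; it is unique up to pointwise equality by
   [is_min_smooth_uniq]. *)
Definition min_smooth (b : nat) : word :=
  epsilon (inhabits (fun _ => 0)) (is_min_smooth b).

(* a^(u 0) c^(u 1) a^(u 2) c^(u 3) ... For u with positive entries, the letter
   number i lies in the first i + 1 blocks. *)
Definition Delta_inv (a c : nat) (u : word) : word := fun i =>
  nth 0 (flatten [seq nseq (u k) (if odd k then c else a) | k <- iota 0 i.+1]) i.

Definition Delta_inv1 (b : nat) (u : word) : word := Delta_inv 1 b u.

Lemma bstartS u k : bstart u k.+1 = bstart u k + u k.
Proof. by rewrite /bstart big_ord_recr. Qed.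

Lemma bstart_ge u k : (forall j, 0 < u j) -> k <= bstart u k.
Proof.
move=> u0; elim: k => // k IH; rewrite bstartS; have := u0 k; lia.
Qed.

Lemma bstart_le u j k : j <= k -> bstart u j <= bstart u k.
Proof.
by move=> /subnK <-; elim: (k - j) => [|n IH] //; rewrite addSn bstartS; lia.
Qed.

Lemma is_Delta_agree w w' u u' n : is_Delta w u -> is_Delta w' u' ->
  (forall i, i <= bstart u n -> w i = w' i) -> forall k, k < n -> u' k = u k.
Proof.
move=> [al Hal] [al' Hal'] Hw.
suff H k : k <= n -> bstart u' k = bstart u k.
  move=> k kn; have := H k (ltnW kn); have := H _ kn; rewrite !bstartS; lia.
elim: k => [|k IH] kn; first by rewrite /bstart !big_ord0.
have {}IH := IH (ltnW kn).
have [u0 alN Hu] := Hal k; have [u0' alN' Hu'] := Hal' k.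
have [uS0 _ HuS] := Hal k.+1; have [uS0' _ HuS'] := Hal' k.+1.
have le := bstart_le u kn.
move: Hu Hu' HuS HuS' le; rewrite !bstartS IH => Hu Hu' HuS HuS' le.
have e0 : al k = al' k.
  by rewrite -(Hu (bstart u k)) -?(Hu' (bstart u k)) ?Hw //; lia.
case: (ltngtP (u k) (u' k)) => [lt|lt|-> //]; exfalso.
- apply: alN; rewrite -(HuS (bstart u k + u k)); last lia.
  by rewrite Hw ?Hu' ?e0 //; lia.
- apply: alN'; rewrite -(HuS' (bstart u k + u' k)); last lia.
  by rewrite -Hw ?Hu ?e0 //; lia.
Qed.

Lemma is_Delta_fun w w' u u' :
  w =1 w' -> is_Delta w u -> is_Delta w' u' -> u' =1 u.
Proof.
by move=> Hw Du Du' k; apply: (is_Delta_agree (n := k.+1) Du Du').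
Qed.

Lemma is_Delta_ext w w' u u' : w =1 w' -> u =1 u' -> is_Delta w u -> is_Delta w' u'.
Proof.
move=> Hw Hu [al H]; exists al => k; have [h1 h2 h3] := H k.
have e j : bstart u' j = bstart u j by apply: eq_bigr => i _; rewrite Hu.
by split=> // [|i]; rewrite -?Hu // !e -Hw; apply: h3.
Qed.

Lemma is_Delta_iter_ext k w w' u : w =1 w' ->
  is_Delta_iter k w u -> is_Delta_iter k w' u.
Proof.
case: k => [|k] /= Hw; first by move=> H i; rewrite -Hw.
by move=> [v [Dv Hv]]; exists v; split=> //; apply: is_Delta_ext Dv.
Qed.

Lemma smooth_over b w : smooth b w -> over b w.
Proof. by move=> /(_ 0) [u /= [e ou]] i; rewrite e. Qed.

Lemma smooth_Delta b w : smooth b w -> exists u, is_Delta w u /\ smooth b u.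
Proof.
move=> sw; have [_ [[u [Du _]] _]] := sw 1; exists u; split=> // k.
have [x [[v [Dv Hv]] ox]] := sw k.+1; exists x; split=> //.
by apply: is_Delta_iter_ext Hv; apply: is_Delta_fun Du Dv.
Qed.

Lemma lexle_anti u v : lexle u v -> lexle v u -> u =1 v.
Proof.
case=> // -[n [Hn ln]]; case=> [e i|[p [Hp lp]]]; first by rewrite e.
case: (ltngtP n p) => [lt|lt|e]; [have := Hp n lt|have := Hn p lt|subst p]; lia.
Qed.

Lemma is_min_smooth_uniq b m m' :
  is_min_smooth b m -> is_min_smooth b m' -> m =1 m'.
Proof. by move=> [s h] [s' h']; apply: lexle_anti; [apply: h|apply: h']. Qed.

Section DeltaInv.
Variables a c : nat.

Let pref (u : word) n :=
  flatten [seq nseq (u k) (if odd k then c else a) | k <- iota 0 n].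

Lemma prefS u n : pref u n.+1 = pref u n ++ nseq (u n) (if odd n then c else a).
Proof.
by rewrite /pref -addn1 iotaD map_cat flatten_cat /= add0n cats0.
Qed.

Lemma size_pref u n : size (pref u n) = bstart u n.
Proof.
elim: n => [|n IH]; first by rewrite /bstart big_ord0.
by rewrite prefS size_cat size_nseq IH bstartS.
Qed.

Lemma nth_pref u n p i : i < bstart u n -> n <= p ->
  nth 0 (pref u p) i = nth 0 (pref u n) i.
Proof.
move=> lt /subnK <-; elim: (p - n) => [|q IH] //.
rewrite addSn prefS nth_cat size_pref ifT ?IH //.
apply: leq_trans lt (bstart_le _ _); lia.
Qed.

Lemma Delta_invK u : a <> c -> (forall k, 0 < u k) -> is_Delta (Delta_inv a c u) u.
Proof.
move=> ac u0; exists (fun k => if odd k then c else a) => k; split=> //.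
  by rewrite /=; case: odd => /=; [|apply: nesym].
move=> i /andP[le lt]; rewrite -[LHS]/(nth 0 (pref u i.+1) i).
rewrite (@nth_pref u k.+1) //; last by have := bstart_ge k u0; lia.
rewrite prefS nth_cat size_pref ltnNge le /= nth_nseq ifT //.
by move: lt; rewrite bstartS; lia.
Qed.

Lemma Delta_inv_over u i : (forall k, 0 < u k) ->
  Delta_inv a c u i = a \/ Delta_inv a c u i = c.
Proof.
move=> u0; have : nth 0 (pref u i.+1) i \in pref u i.+1.
  by apply: mem_nth; rewrite size_pref; apply: bstart_ge.
move=> /flattenP [s /mapP [k _ ->]] /nseqP [].
by rewrite -[nth _ _ _]/(Delta_inv a c u i) => -> _; case: odd; auto.
Qed.

Lemma Delta_inv_agree u v n : (forall k, 0 < u k) -> 1 < u 0 ->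
  (forall i, i < n -> u i = v i) -> 0 < n ->
  forall i, i <= n -> Delta_inv a c u i = Delta_inv a c v i.
Proof.
move=> u0 u1 uv n0 i le.
have e : pref u n = pref v n.
  rewrite /pref; congr flatten; apply/eq_in_map => k.
  by rewrite mem_iota => /andP[_ lt]; rewrite uv.
have eb : bstart v n = bstart u n by rewrite -!size_pref e.
have lt : n < bstart u n.
  case: n n0 {uv le e eb} => // n _; elim: n => [|n IH].
    by rewrite bstartS /bstart big_ord0.
  by rewrite bstartS; have := u0 n.+1; lia.
have ltin : i < bstart u n by lia.
rewrite -[LHS]/(nth 0 (pref u i.+1) i) -[RHS]/(nth 0 (pref v i.+1) i).
case: (ltnP i n) => lin.
  congr (nth _ (flatten _) _); apply/eq_in_map => k.
  by rewrite mem_iota => /andP[_ lk]; rewrite uv //; lia.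
have ein : i = n by lia.
by rewrite ein !(@nth_pref _ n) ?eb ?e //.
Qed.

End DeltaInv.

Section Existence.
Variable b : nat.
Hypothesis b1 : 1 < b.

Lemma smooth_inhabited : exists w, smooth b w.
Proof.
pose W n := iter n (Delta_inv b 1) (fun _ => b) : word.
have Wov n i : W n i = b \/ W n i = 1.
  elim: n i => [|n IH] i; first by left.
  by apply: (@Delta_inv_over b 1 (W n)) => k; case: (IH k) => ->; lia.
have Wpos n i : 0 < W n i by case: (Wov n i) => ->; lia.
have W0 n : W n 0 = b.
  case: n => // n; rewrite [LHS]/(Delta_inv b 1 (W n) 0) /Delta_inv /=.
  by have := Wpos n 0; case: (W n 0).
have step n i : i <= n -> W n i = W n.+1 i.
  elim: n i => [|n IH] i le.
    by move: le; rewrite leqn0 => /eqP ->; rewrite !W0.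
  apply: (@Delta_inv_agree b 1 (W n) (W n.+1) n.+1) => //.
  by rewrite W0.
have stab n i : i <= n -> W n i = W i i.
  move=> /subnK <-; elim: (n - i) => // p <-.
  by rewrite addSn -step //; lia.
pose K : word := fun i => W i i.
have DK : is_Delta K K.
  have Kpos k : 0 < K k by apply: Wpos.
  apply: (is_Delta_ext _ (fun=> erefl)) (@Delta_invK b 1 K _ Kpos); last lia.
  move=> i; rewrite [RHS](_ : _ = W i.+1 i); last by rewrite -step.
  apply: (@Delta_inv_agree b 1 K (W i) i.+1) => //.
  by move=> j lj; rewrite /K stab //; lia.
exists K => k; exists K; split; last by move=> i; case: (Wov i i); [right|left].
by elim: k => [|k IH] //=; exists K.
Qed.

(* m is in the closure of the set of smooth words. *)
Let approx (m : word) :=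
  forall n, exists w, smooth b w /\ forall i, i < n -> m i = w i.

Lemma approx_over m : approx m -> over b m.
Proof.
by move=> am i; have [w [sw e]] := am i.+1; rewrite e //; apply: smooth_over.
Qed.

Lemma smooth_change w i : smooth b w -> exists j, i < j <= i + b /\ w j <> w i.
Proof.
move=> /smooth_Delta [u [[al H] /smooth_over ou]].
have [k /andP[le lt]] : exists k, bstart u k <= i < bstart u k.+1.
  have u0 k : 0 < u k by have [] := H k.
  have ex : exists k, i < bstart u k by exists i.+1; apply: bstart_ge.
  have := ex_minnP ex; case=> -[|k]; first by rewrite /bstart big_ord0.
  move=> lt mn; exists k; rewrite lt andbT leqNgt.
  by apply/negP => /mn; rewrite ltnn.
have [_ alN Hk] := H k; have [u0 _ HkS] := H k.+1.
exists (bstart u k.+1); split.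
  by move: lt; rewrite bstartS; case: (ou k) => ->; lia.
by rewrite (Hk i) ?le ?lt // HkS // (bstartS u k.+1); lia.
Qed.

Lemma approx_Delta m : approx m -> exists v, is_Delta m v /\ approx v.
Proof.
move=> am.
have ex i : exists j, (i < j) && (m j != m i).
  have [w [sw e]] := am (i + b).+1.
  have [j [/andP[lt le] ne]] := smooth_change i sw.
  by exists j; rewrite lt !e; [apply/eqP|lia..].
pose nxt i := ex_minn (ex i).
have nlt i : i < nxt i by rewrite /nxt; case: ex_minnP => j /andP[].
have nne i : m (nxt i) <> m i.
  by rewrite /nxt; case: ex_minnP => j /andP[_ /eqP].
have nmin i j : i <= j < nxt i -> m j = m i.
  move=> /andP[le]; rewrite /nxt; case: ex_minnP => p _ mn lt.
  apply/eqP; apply: contraTT lt => ne; rewrite -leqNgt mn // ne andbT.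
  by rewrite ltn_neqAle le andbT; apply: contraNneq ne => ->.
pose s k := iter k nxt 0.
pose v : word := fun k => s k.+1 - s k.
have vs k : bstart v k = s k.
  elim: k => [|k IH]; first by rewrite /bstart big_ord0.
  by rewrite bstartS IH /v /=; have := nlt (s k); lia.
have Dv : is_Delta m v.
  exists (fun k => m (s k)) => k; split; first by rewrite /v subn_gt0 nlt.
    exact: nne.
  by move=> i; rewrite !vs; apply: nmin.
exists v; split=> // n.
have [w [sw e]] := am (bstart v n).+1.
have [u [Du su]] := smooth_Delta sw.
by exists u; split=> // k kn; rewrite (is_Delta_agree Dv Du _ kn).
Qed.

Lemma approx_smooth m : approx m -> smooth b m.
Proof.
move=> am k; elim: k m am => [|k IH] m am.
  by exists m; split=> //; apply: approx_over.
have [v [Dv av]] := approx_Delta am; have [u [Hu ou]] := IH v av.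
by exists u; split=> //; exists v.
Qed.

Lemma is_min_smooth_exists : exists m, is_min_smooth b m.
Proof.
pose ext (s : seq nat) (x : nat) := exists w,
  [/\ smooth b w, forall i, i < size s -> w i = nth 0 s i & w (size s) = x].
pose nxt s := if excluded_middle_informative (ext s 1) then 1 else b.
pose p n := iter n (fun s => rcons s (nxt s)) [::].
have sp n : size (p n) = n by elim: n => //= n IH; rewrite size_rcons IH.
pose m : word := fun n => nxt (p n).
have pm n i : i < n -> nth 0 (p n) i = m i.
  elim: n => // n IH lt /=; rewrite nth_rcons sp.
  by case: (ltngtP i n) lt => [lt _|lt|-> _] //; [apply: IH|lia].
have extb n w : smooth b w -> (forall i, i < n -> w i = m i) -> ext (p n) (w n).
  move=> sw e; exists w; split=> //; rewrite sp // => i lt.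
  by rewrite pm // e.
have am : approx m.
  elim=> [|n [w [sw e]]]; first by have [w sw] := smooth_inhabited; exists w.
  have ew : ext (p n) (w n) by apply: extb => // i lt; rewrite e.
  have [w' [sw' e' ew']] : ext (p n) (m n).
    rewrite /m /nxt; case: excluded_middle_informative => // n1.
    by case: (smooth_over sw n) ew => ->.
  move: e' ew'; rewrite sp => e' ew'; exists w'; split=> // i.
  rewrite ltnS leq_eqVlt => /orP[/eqP -> //|lt].
  by rewrite e' // pm.
exists m; split; first exact: approx_smooth.
move=> w sw; case: (classic (m =1 w)) => [|ne]; [by left|right].
have ex : exists n, m n != w n.
  apply: NNPP => nex; apply: ne => i; apply/eqP.
  by apply/negPn/negP => h; apply: nex; exists i.
case: (ex_minnP ex) => n ne' mn; exists n.
have eq i : i < n -> m i = w i.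
  by move=> lt; apply/eqP; apply: contraTT lt => /mn; rewrite -leqNgt.
split=> //; have ew : ext (p n) (w n) by apply: extb => // i /eq.
move: ne'; rewrite /m /nxt; case: (excluded_middle_informative (ext (p n) 1)) => [y|n1].
  by case: (smooth_over sw n) => ->; [rewrite eqxx|].
by case: (smooth_over sw n) ew => -> //; rewrite eqxx.
Qed.

Lemma min_smoothP : is_min_smooth b (min_smooth b).
Proof. exact: epsilon_spec is_min_smooth_exists. Qed.

End Existence.

(* Main.v *)
Require Import Defs.
From mathcomp Require Import all_boot.
From mathcomp Require Import zify.
From Stdlib Require Import Classical FunctionalExtensionality.

(* As b is odd, positions and block numbers have the same parity at every block
   start. Hence Delta_inv b 1 turns the lexicographic order into the alternating
   order (reversed at even positions), Delta_inv 1 b turns the latter into the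
   lexicographic order, and their composite F is increasing; therefore the minimal
   smooth word m satisfies m = F m. By infinite descent m has only letters 1 at
   even positions, so that comparing m with its suffixes reduces through F to
   shorter suffixes: m is Lyndon, and so is Delta_inv 1 b m.
   Conversely, let w = Delta_inv 1 b u be smooth and Lyndon. If u starts with b,
   then w = F v with v again Lyndon of this kind, so the descent determines w,
   which is m. If u starts with 1, then u is itself Lyndon of the first kind, so
   u = m. *)

Set Implicit Arguments.
Unset Strict Implicit.
Unset Printing Implicit Defensive.

(** * Blocks and suffixes of [Delta_inv] *)

Lemma bstart0 u : bstart u 0 = 0.
Proof. by rewrite /bstart big_ord0. Qed.

Lemma block_exists (u : word) i : (forall k, 0 < u k) ->
  exists k j, j < u k /\ i = bstart u k + j.
Proof.
move=> u0; elim: i => [|i [k [j [lt ->]]]].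
  by exists 0, 0; rewrite bstart0.
have [lt'|le] := ltnP j.+1 (u k); first by exists k, j.+1; rewrite addnS.
by exists k.+1, 0; rewrite bstartS; split=> //; lia.
Qed.

Lemma eq_bstart (u v : word) n : (forall i, i < n -> u i = v i) ->
  bstart u n = bstart v n.
Proof. by move=> e; apply: eq_bigr => i _; apply: e. Qed.

Lemma odd_bstart (u : word) k : (forall i, odd (u i)) -> odd (bstart u k) = odd k.
Proof.
move=> ou; elim: k => [|k IH]; first by rewrite bstart0.
by rewrite bstartS oddD IH ou addbT.
Qed.

Lemma Delta_inv_block a c (u : word) k j : (forall k, 0 < u k) -> j < u k ->
  Delta_inv a c u (bstart u k + j) = if odd k then c else a.
Proof.
move=> u0 lt; rewrite /Delta_inv (@nth_pref _ _ u k.+1).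
- by rewrite prefS nth_cat size_pref ltnNge leq_addr /= addKn nth_nseq lt.
- by rewrite bstartS ltn_add2l.
- by have := bstart_ge k u0; lia.
Qed.

(* The block lengths of the suffix which starts at letter number j of block
   number k, when u gives the block lengths of the whole word. *)
Definition cut (u : word) k j : word :=
  fun i => if i is 0 then u k - j else u (k + i).

Lemma cut0 u k : cut u k 0 = suffix_at k u.
Proof.
by apply: functional_extensionality => -[|i]; rewrite /cut /suffix_at ?addn0 ?subn0.
Qed.

Lemma cut_pos (u : word) k j : (forall i, 0 < u i) -> j < u k ->
  forall i, 0 < cut u k j i.
Proof. by move=> u0 lt [|i] //=; rewrite subn_gt0. Qed.

Lemma cut_odd (u : word) k j : (forall i, odd (u i)) -> j < u k -> ~~ odd j ->
  forall i, odd (cut u k j i).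
Proof. by move=> ou lt oj [|i] //=; rewrite oddB ?ou ?(negPf oj) // ltnW. Qed.

Lemma bstart_cut u k j l : j <= u k ->
  bstart u k + j + bstart (cut u k j) l.+1 = bstart u (k + l.+1).
Proof.
move=> le; elim: l => [|l IH].
  by rewrite addn1 !bstartS bstart0 /=; lia.
by rewrite bstartS addnA IH [k + l.+2]addnS bstartS.
Qed.

Lemma suffix_Delta_inv a c (u : word) k j : (forall i, 0 < u i) -> j < u k ->
  suffix_at (bstart u k + j) (Delta_inv a c u) =
  if odd k then Delta_inv c a (cut u k j) else Delta_inv a c (cut u k j).
Proof.
move=> u0 lt; apply: functional_extensionality => i.
have c0 := cut_pos u0 lt.
have [l [r [ltr ->]]] := block_exists i c0.
rewrite /suffix_at.
have -> : Delta_inv a c u (bstart u k + j + (bstart (cut u k j) l + r)) =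
    if odd (k + l) then c else a.
  case: l ltr => [|l] ltr.
    rewrite bstart0 add0n addn0 -addnA Delta_inv_block //.
    by move: ltr => /=; lia.
  by rewrite addnA bstart_cut ?Delta_inv_block // ltnW.
by rewrite oddD; case: (odd k); rewrite Delta_inv_block //; case: odd.
Qed.

(** At the end of block n of u, its word changes letter while the word of v is still inside its
    longer block n. *)
Lemma Delta_inv_diff a c (u v : word) n (p := bstart u n + u n) :
  (forall i, 0 < u i) -> (forall i, 0 < v i) ->
  (forall i, i < n -> u i = v i) -> u n < v n ->
  [/\ forall i, i < p -> Delta_inv a c u i = Delta_inv a c v i,
      Delta_inv a c u p = if odd n then a else c &
      Delta_inv a c v p = if odd n then c else a].
Proof.
move=> u0 v0 e lt; split.
- move=> i ltp; have [k [j [ltj ei]]] := block_exists i u0.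
  have kn : k <= n.
    rewrite leqNgt; apply/negP => /(bstart_le u); rewrite bstartS.
    by move: ltp; rewrite ei /p; lia.
  have ebs : bstart u k = bstart v k by apply: eq_bstart => q lq; apply: e; lia.
  have ltj' : j < v k.
    by move: kn; rewrite leq_eqVlt => /orP[/eqP ek|/e <- //]; subst k; lia.
  by rewrite ei Delta_inv_block // ebs Delta_inv_block.
- rewrite /p -bstartS -[bstart u n.+1]addn0 Delta_inv_block //=.
  by case: odd.
- by rewrite /p (eq_bstart e) Delta_inv_block.
Qed.

Lemma eq_Delta_inv a c (u v : word) n : (forall i, i < n -> u i = v i) ->
  forall i, i < n -> Delta_inv a c u i = Delta_inv a c v i.
Proof.
move=> e i lt; congr (nth _ (flatten _) _); apply/eq_in_map => k.
by rewrite mem_iota => /andP[_ lk]; rewrite e //; lia.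
Qed.

(** * Lexicographic and alternating orders *)

(* The order on block lengths induced by Delta_inv 1 b: a longer block of 1 makes
   the word smaller, a longer block of b makes it larger. *)
Definition altlt (u v : word) : Prop :=
  exists n, (forall i, i < n -> u i = v i) /\
            (if odd n then u n < v n else v n < u n).

Lemma first_diff (u v : word) :
  u = v \/ exists n, (forall i, i < n -> u i = v i) /\ u n <> v n.
Proof.
have [e|ne] := classic (forall i, u i = v i).
  by left; apply: functional_extensionality.
right; have ex : exists n, u n != v n.
  apply: NNPP => nex; apply: ne => i; apply/eqP/negPn/negP => h.
  by apply: nex; exists i.
case: (ex_minnP ex) => n /eqP ne' mn; exists n; split=> // i lt.
by apply/eqP; apply: contraTT lt => /mn; rewrite -leqNgt.
Qed.

Lemma lexlt_total u v : [\/ u = v, lexlt u v | lexlt v u].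
Proof.
have [->|[n [e ne]]] := first_diff u v; first by constructor 1.
case: (ltngtP (u n) (v n)) => // lt; [constructor 2|constructor 3]; exists n => //.
by split=> // i /e.
Qed.

Lemma altlt_total u v : [\/ u = v, altlt u v | altlt v u].
Proof.
have [->|[n [e ne]]] := first_diff u v; first by constructor 1.
have e' i : i < n -> v i = u i by move=> /e.
case: (ltngtP (u n) (v n)) => // lt; case: (boolP (odd n)) => on;
  [constructor 2|constructor 3|constructor 3|constructor 2];
  by exists n; rewrite ?on ?(negPf on).
Qed.

Lemma lexlt_asym u v : lexlt u v -> lexlt v u -> False.
Proof.
move=> [n [e l]] [p [e' l']].
by case: (ltngtP n p) => [/e' eq|/e eq|eq]; [| |subst p]; lia.
Qed.

Lemma altlt_asym u v : altlt u v -> altlt v u -> False.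
Proof.
move=> [n [e l]] [p [e' l']].
case: (ltngtP n p) => [/e' eq|/e eq|eq]; last subst p; move: l l'.
- by case: (odd n); lia.
- by case: (odd p); lia.
- by case: odd; lia.
Qed.

Lemma lexlt_head u v : lexlt u v -> u 0 <= v 0.
Proof. by move=> [[|n] [e l]]; [apply: ltnW | rewrite e]. Qed.

Lemma altlt_head u v : altlt u v -> v 0 <= u 0.
Proof. by move=> [[|n] [e l]]; [apply: ltnW | rewrite e]. Qed.

Lemma lexlt_altlt u v : (forall k, ~~ odd k -> u k = v k) -> lexlt u v -> altlt u v.
Proof.
move=> H [n [e l]]; exists n; split=> //.
by case: (boolP (odd n)) => // /H h; move: l; rewrite h ltnn.
Qed.

Lemma altlt_lexlt u v : (forall k, ~~ odd k -> u k = v k) -> altlt u v -> lexlt u v.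
Proof.
move=> H [n [e l]]; exists n; split=> //; move: l.
by case: (boolP (odd n)) => // /H ->; rewrite ltnn.
Qed.

Lemma head_lexlt (u v : word) : u 0 < v 0 -> lexlt u v.
Proof. by exists 0. Qed.

Lemma head_altlt (u v : word) : v 0 < u 0 -> altlt u v.
Proof. by exists 0. Qed.

(** * Monotonicity of [Delta_inv] and smooth preimages *)

Section Odd.
Variable b : nat.
Hypotheses (b1 : 1 < b) (ob : odd b).

Local Notation D1 := (Delta_inv 1 b).
Local Notation Db := (Delta_inv b 1).

Lemma lexlt_D1 (u v : word) : (forall i, 0 < u i) -> (forall i, 0 < v i) ->
  altlt u v -> lexlt (D1 u) (D1 v).
Proof.
move=> u0 v0 [n [e]]; case: (boolP (odd n)) => on lt.
  have [h eu ev] := Delta_inv_diff 1 b u0 v0 e lt.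
  by eexists; split; first exact: h; rewrite eu ev on.
have e' i : i < n -> v i = u i by move=> /e.
have [h ev eu] := Delta_inv_diff 1 b v0 u0 e' lt.
by eexists; split; first (by move=> i /h); rewrite eu ev (negPf on).
Qed.

Lemma altlt_of_D1 (u v : word) : (forall i, 0 < u i) -> (forall i, 0 < v i) ->
  lexlt (D1 u) (D1 v) -> altlt u v.
Proof.
move=> u0 v0 lt; case: (altlt_total u v) => // [e|/(lexlt_D1 v0 u0) gt].
  by case: (lexlt_asym lt); move: lt; rewrite e.
by case: (lexlt_asym lt gt).
Qed.

(** With odd entries, a first difference in block n shows at a position of parity opposite to n,
    where the direction of [altlt] fits the letter of that block. *)
Lemma altlt_Db (u v : word) : (forall i, odd (u i)) -> (forall i, odd (v i)) ->
  lexlt u v -> altlt (Db u) (Db v).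
Proof.
move=> ou ov [n [e lt]].
have [h eu ev] := Delta_inv_diff b 1 (fun i => odd_gt0 (ou i))
  (fun i => odd_gt0 (ov i)) e lt.
eexists; split; first exact: h.
by rewrite eu ev oddD ou odd_bstart //; case: odd.
Qed.

Lemma lexlt_of_Db (u v : word) : (forall i, odd (u i)) -> (forall i, odd (v i)) ->
  altlt (Db u) (Db v) -> lexlt u v.
Proof.
move=> ou ov lt; case: (lexlt_total u v) => // [e|/(altlt_Db ov ou) gt].
  by case: (altlt_asym lt); move: lt; rewrite e.
by case: (altlt_asym lt gt).
Qed.

Lemma Delta_inv_pos a c (u : word) : 0 < a -> 0 < c -> (forall i, 0 < u i) ->
  forall i, 0 < Delta_inv a c u i.
Proof. by move=> a0 c0 u0 i; case: (Delta_inv_over a c i u0) => ->. Qed.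

Lemma Delta_inv0 a c (u : word) : 0 < u 0 -> Delta_inv a c u 0 = a.
Proof. by rewrite /Delta_inv /=; case: (u 0). Qed.

Lemma over_odd u : Defs.over b u -> forall i, odd (u i).
Proof. by move=> ou i; case: (ou i) => ->. Qed.

Lemma over_pos u : Defs.over b u -> forall i, 0 < u i.
Proof. by move=> /over_odd ou i; apply: odd_gt0. Qed.

Lemma smooth_odd u : smooth b u -> forall i, odd (u i).
Proof. by move=> /smooth_over/over_odd. Qed.

Lemma smooth_pos u : smooth b u -> forall i, 0 < u i.
Proof. by move=> /smooth_over/over_pos. Qed.

Lemma smooth_Delta_inv a c u : a <> c -> a = 1 \/ a = b -> c = 1 \/ c = b ->
  smooth b u -> smooth b (Delta_inv a c u).
Proof.
move=> ac a1 c1 su [|k].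
  exists (Delta_inv a c u); split=> // i.
  by case: (Delta_inv_over a c i (smooth_pos su)) => ->.
have [x [dx ox]] := su k; exists x; split=> //; exists u; split=> //.
exact: Delta_invK (smooth_pos su).
Qed.

Lemma smooth_D1 u : smooth b u -> smooth b (D1 u).
Proof. by apply: smooth_Delta_inv; lia. Qed.

Lemma smooth_Db u : smooth b u -> smooth b (Db u).
Proof. by apply: smooth_Delta_inv; lia. Qed.

(** With two letters the blocks must alternate, so the first letter and the block lengths determine
    w. *)
Lemma smooth_Delta_invP w : smooth b w -> exists u, smooth b u /\
  w = if w 0 == 1 then D1 u else Db u.
Proof.
move=> sw; have ow := smooth_over sw.
have [u [[al H] su]] := smooth_Delta sw; exists u; split=> //.
have u0 := smooth_pos su.
have Hw k j : j < u k -> w (bstart u k + j) = al k.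
  by move=> lt; have [_ _] := H k; apply; rewrite bstartS; lia.
have alo k : al k = 1 \/ al k = b.
  by rewrite -(Hw k 0) //; apply: ow.
have al0 : w 0 = al 0 by rewrite -(Hw 0 0) // /bstart big_ord0.
have alk k : al k = if odd k == (w 0 == 1) then b else 1.
  elim: k => [|k IH].
    by rewrite al0; case: (alo 0) => -> //; case: eqP => //; lia.
  have [_ ne _] := H k; move: ne; rewrite IH /=.
  by case: odd; case: (w 0 == 1) => /=; case: (alo k.+1) => ->; lia.
apply: functional_extensionality => i; have [k [j [lt ->]]] := block_exists i u0.
rewrite Hw // alk; case: (w 0 == 1); rewrite Delta_inv_block //; by case: odd.
Qed.

Lemma smooth_D1P w : smooth b w -> w 0 = 1 -> exists u, smooth b u /\ w = D1 u.
Proof.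
by move=> /smooth_Delta_invP [u [su e]] w0; exists u; split=> //; rewrite e w0.
Qed.

Lemma smooth_DbP w : smooth b w -> w 0 = b -> exists u, smooth b u /\ w = Db u.
Proof.
move=> /smooth_Delta_invP [u [su e]] w0; exists u; split=> //; rewrite e w0.
by case: eqP => // eb; lia.
Qed.

Lemma smooth_head w : smooth b w -> w 0 = 1 \/ w 0 = b.
Proof. by move=> /smooth_over. Qed.

Lemma lexlt_F (u v : word) : (forall i, odd (u i)) -> (forall i, odd (v i)) ->
  lexlt u v -> lexlt (D1 (Db u)) (D1 (Db v)).
Proof.
move=> ou ov lt; apply: lexlt_D1; last exact: altlt_Db.
  by apply: Delta_inv_pos; [lia..| move=> i; apply: odd_gt0].
by apply: Delta_inv_pos; [lia..| move=> i; apply: odd_gt0].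
Qed.

Lemma lexlt_suffix_head w k : w 0 = 1 -> w k = b -> lexlt w (suffix_at k w).
Proof. by move=> w0 wk; apply: head_lexlt; rewrite /suffix_at addn0 w0 wk. Qed.

(** A suffix starting in a block of b is larger at once; only starts inside blocks of 1 need a
    comparison. *)
Lemma D1_suffix_cases u k : (forall i, 0 < u i) -> 0 < k ->
  lexlt (D1 u) (suffix_at k (D1 u)) \/
  exists K j, [/\ ~~ odd K, j < u K, 0 < K + j, k = bstart u K + j &
    suffix_at k (D1 u) = D1 (cut u K j)].
Proof.
move=> u0 k0; have [K [j [lt ek]]] := block_exists k u0.
case: (boolP (odd K)) => oK.
  left; apply: lexlt_suffix_head; first by rewrite Delta_inv0.
  by rewrite ek Delta_inv_block // oK.
right; exists K, j; split=> //; last by rewrite ek suffix_Delta_inv // (negPf oK).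
by case: K {lt oK} ek => // ; rewrite bstart0; lia.
Qed.

(** The first block has the maximal length b, so a suffix with fewer leading letters 1 is larger;
    only starts of blocks 1^b remain. *)
Lemma D1_suffix_cases_b u k : Defs.over b u -> u 0 = b -> 0 < k ->
  lexlt (D1 u) (suffix_at k (D1 u)) \/
  exists K, [/\ ~~ odd K, 0 < K, u K = b, k = bstart u K &
    suffix_at k (D1 u) = D1 (suffix_at K u)].
Proof.
move=> ou u0 k0; have up := over_pos ou.
have [|[K [j [oK lt Kj ek ->]]]] := D1_suffix_cases up k0; first by left.
have [lb|eb] : cut u K j 0 < b \/ j = 0 /\ u K = b.
  by rewrite /cut; case: (ou K) lt => ->; lia.
  left; apply: lexlt_D1 => //; first exact: cut_pos.
  by apply: head_altlt; rewrite u0.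
by right; case: eb Kj ek => -> uK; rewrite !addn0 cut0; exists K.
Qed.

Lemma lyndon_D1_altlt u K j : (forall i, 0 < u i) -> lyndon (D1 u) -> ~~ odd K ->
  j < u K -> 0 < K + j -> altlt u (cut u K j).
Proof.
move=> up ly oK lt Kj; apply: altlt_of_D1 => //; first exact: cut_pos.
have := ly (bstart u K + j); rewrite suffix_Delta_inv // (negPf oK); apply.
by have := bstart_ge K up; lia.
Qed.

(** Evenness of l and i puts the cut of [Db v] at an even position, hence at a block of 1 in
    [D1 (Db v)], and keeps the entries of [cut v l i] odd. *)
Lemma lyndon_F_lexlt v l i : (forall i, odd (v i)) -> lyndon (D1 (Db v)) ->
  ~~ odd l -> ~~ odd i -> i < v l -> 0 < l + i -> lexlt v (cut v l i).
Proof.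
move=> ov ly ol oi lt li; have vp j : 0 < v j by apply: odd_gt0.
have up : forall j, 0 < Db v j by apply: Delta_inv_pos => //; lia.
apply: lexlt_of_Db => //; first exact: cut_odd.
have := suffix_Delta_inv b 1 vp lt; rewrite (negPf ol) -cut0 => <-.
apply: lyndon_D1_altlt => //.
  by rewrite oddD odd_bstart // (negPf ol) (negPf oi).
by have := bstart_ge l vp; lia.
Qed.

(** * The minimal smooth word *)

Section Minimal.
Variable m : word.
Hypothesis min_m : is_min_smooth b m.

Let sm : smooth b m.
Proof. by case: min_m. Qed.

Lemma min_smooth_le w : smooth b w -> lexlt w m -> False.
Proof.
move=> sw lt; case: (min_m) => _ /(_ w sw) [e|/lexlt_asym]; last exact.
case: lt => n [_]; rewrite e; lia.
Qed.

(** Minimality forces the first letter 1, then a first block of length b; as F is increasing, v is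
    again minimal, hence equal to m. *)
Lemma min_smooth_eqF : m = D1 (Db m) /\ m 0 = 1.
Proof.
have m0 : m 0 = 1.
  case: (smooth_head sm) => // mb; case: (@min_smooth_le (D1 m)).
    exact: smooth_D1.
  by apply: head_lexlt; rewrite Delta_inv0 ?smooth_pos // mb.
split=> //; have [u [su em]] := smooth_D1P sm m0.
have u0 : u 0 = b.
  case: (smooth_head su) => // u1; case: (@min_smooth_le (D1 (Db m))).
    by apply: smooth_D1; apply: smooth_Db.
  rewrite em; apply: lexlt_D1; try by apply: smooth_pos => //; apply: smooth_Db.
    by rewrite -em; apply: smooth_pos => //; apply: smooth_Db.
  by apply: head_altlt; rewrite -em Delta_inv0 ?smooth_pos // u1; lia.
have [v [sv eu]] := smooth_DbP su u0.
have min_v : is_min_smooth b v.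
  split=> // x sx; case: (lexlt_total v x) => [->|lt|lt]; [by left|by right|].
  case: (@min_smooth_le (D1 (Db x))); first by apply: smooth_D1; apply: smooth_Db.
  by rewrite em eu; apply: lexlt_F => //; apply: smooth_odd.
have -> : Db m = Db v.
  by congr (Delta_inv b 1 _); apply: functional_extensionality;
    exact: (is_min_smooth_uniq min_m min_v).
by rewrite -eu.
Qed.

Let emF : m = D1 (Db m).
Proof. by case: min_smooth_eqF. Qed.

Let m0 : m 0 = 1.
Proof. by case: min_smooth_eqF. Qed.

Let sDb : smooth b (Db m).
Proof. exact: smooth_Db. Qed.

Let Dbm0 : Db m 0 = b.
Proof. by rewrite Delta_inv0 // m0. Qed.

(** Strictness makes the descents through F reach a smaller index. *)
Lemma bstart_gt (u : word) k : (forall i, 0 < u i) -> 1 < u 0 -> 0 < k ->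
  k < bstart u k.
Proof.
move=> up u1; elim: k => // -[|k] IH _; first by rewrite bstartS bstart0.
by rewrite bstartS; have := IH isT; have := up k.+1; lia.
Qed.

(* Infinite descent: a letter b at an even position of m lies inside a block of
   length b, which in turn comes from a letter b at a smaller even position of
   Delta^2(m) = m. *)
Lemma min_smooth_even k : ~~ odd k -> m k = 1.
Proof.
elim/ltn_ind: k => k IH ok; case: (smooth_over sm k) => // mk.
have up := smooth_pos sDb; have mp := smooth_pos sm.
have [K [j [lt ek]]] := block_exists k up.
have [l [i [lt' eK]]] := block_exists K mp.
have oK : odd K.
  by move: mk; rewrite emF ek Delta_inv_block //; case: odd => //; lia.
have oj : odd j by move: ok; rewrite ek oddD odd_bstart ?oK ?negbK //; apply: smooth_odd.
have uK : Db m K = b by case: (smooth_over sDb K) lt oj => // ->; case: j {ek}.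
have ol : ~~ odd l.
  by move: uK; rewrite eK Delta_inv_block //; case: odd => //; lia.
have oi : odd i.
  by move: oK; rewrite eK oddD odd_bstart ?(negPf ol) //; apply: smooth_odd.
have lk : l < k.
  have := bstart_ge l mp; have := @bstart_gt _ K up; rewrite Dbm0; lia.
(* By induction block l has length 1, which leaves no room for the odd offset i. *)
by move: lt'; rewrite (IH l) //; case: i oi {eK}.
Qed.

(** Strong induction: since m l = 1 forces offset 0, a suffix starting with 1^b is the image under F
    of a suffix at some l < k. *)
Lemma min_smooth_lyndon : lyndon m.
Proof.
move=> k; elim/ltn_ind: k => k IH k0.
have up := smooth_pos sDb; have mp := smooth_pos sm.
rewrite {1}emF [X in suffix_at k X]emF.
have [//|[K [oK K0 uK ek ->]]] := D1_suffix_cases_b (smooth_over sDb) Dbm0 k0.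
apply: lexlt_D1 => //; first by move=> i; apply: up.
have [l [i [lt eK]]] := block_exists K mp.
have ol : ~~ odd l.
  by move: uK; rewrite eK Delta_inv_block //; case: odd => //; lia.
have ml := min_smooth_even ol; have i0 : i = 0 by lia.
rewrite i0 addn0 in eK.
rewrite eK -[bstart m l]addn0 suffix_Delta_inv // (negPf ol) cut0.
apply: altlt_Db; [exact: smooth_odd|by move=> j; apply: (smooth_odd sm)|].
apply: IH.
  have := bstart_ge l mp; have := @bstart_gt _ K up; rewrite Dbm0; lia.
by case: l {ol lt ml} eK => //; rewrite bstart0; lia.
Qed.

(** As m is 1 at even positions, [lexlt] and [altlt] agree between m and its suffixes at even
    positions. *)
Lemma min_smooth_D1_lyndon : lyndon (D1 m).
Proof.
move=> k k0; have mp := smooth_pos sm.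
have [//|[K [j [oK lt Kj ek ->]]]] := D1_suffix_cases mp k0.
have mK := min_smooth_even oK; have j0 : j = 0 by lia.
rewrite j0 cut0; apply: lexlt_D1 => //; first by move=> i; apply: mp.
apply: lexlt_altlt; last by apply: min_smooth_lyndon; lia.
by move=> i oi; rewrite /suffix_at !min_smooth_even // oddD (negPf oK).
Qed.

End Minimal.

(** * Lyndon smooth words beginning with 1^b: descent and uniqueness *)

Definition lyndon_b w : Prop :=
  [/\ smooth b w, lyndon w & exists2 u, smooth b u /\ u 0 = b & w = D1 u].

(* If x started with 1 b, then a suffix 1 1 ... would be too small, so x would be
   (1 b)^omega and Delta(x) = 1^omega would not be smooth. *)
Lemma even_one_lyndon_b x : smooth b x -> (forall k, ~~ odd k -> x k = 1) ->
  (forall k, ~~ odd k -> 0 < k -> altlt x (suffix_at k x)) -> lyndon_b x.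
Proof.
move=> sx xe xlt; have [y [sy ex]] := smooth_D1P sx (xe 0 isT).
have yp := smooth_pos sy.
have y0 : y 0 = b.
  case: (smooth_head sy) => // y1; exfalso.
  have x1 : x 1 = b.
    have := Delta_inv_block 1 b (k := 1) (j := 0) yp (yp 1).
    by rewrite -ex bstartS bstart0 y1.
  have xo k : odd k -> x k = b.
    case: k => // k ok; case: (posnP k) => [-> //|k0].
    (* The first difference is not at 0, where both letters are 1, nor at 1, since x 1 = b is
       maximal; so the suffix also has b at index 1. *)
    have [[|[|n]] [e l]] := xlt k ok k0.
    - by move: l; rewrite /suffix_at addn0 (xe 0) // (xe k).
    - by move: l; rewrite /suffix_at addn1 x1 /=; case: (smooth_over sx k.+1) => ->; lia.
    - by have := e 1 isT; rewrite /suffix_at addn1 x1.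
  have y1all k : y k = 1.
    case: (smooth_over sy k) => // yk; exfalso.
    (* Offsets 0 and 1 of a block of length b have both parities, so x would take both letters in
       it. *)
    have [h1 h2] : odd (bstart y k + ~~ odd k) /\ ~~ odd (bstart y k + odd k).
      by rewrite !oddD !odd_bstart; [case: (odd k)|exact: smooth_odd..].
    by move: (xo _ h1) (xe _ h2); rewrite ex !Delta_inv_block ?yk //; lia.
  by have [j [_]] := smooth_change b1 0 sy; rewrite !y1all.
split=> //; last by exists y.
move=> k k0; rewrite {1}ex [X in suffix_at k X]ex.
have [//|[K [oK K0 _ ek _]]] := D1_suffix_cases_b (smooth_over sy) y0 k0.
have ok : ~~ odd k by rewrite ek odd_bstart //; apply: smooth_odd.
rewrite -ex; apply: altlt_lexlt; last exact: xlt.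
by move=> i oi; rewrite /suffix_at !xe // oddD (negPf ok).
Qed.

(** F reflects the order, so v inherits from w comparisons with its even cuts; the work is to show
    that the first block of v has length b. *)
Lemma lyndon_b_step w : lyndon_b w -> exists2 v, lyndon_b v & w = D1 (Db v).
Proof.
move=> [sw lw [u [su u0] ew]]; have [v [sv eu]] := smooth_DbP su u0.
exists v; last by rewrite -eu.
have vp := smooth_pos sv; have vodd := smooth_odd sv.
have C l i : ~~ odd l -> ~~ odd i -> i < v l -> 0 < l + i -> lexlt v (cut v l i).
  by apply: lyndon_F_lexlt => //; rewrite -eu -ew.
have v0 : v 0 = 1.
  case: (smooth_head sv) => // v0; exfalso.
  (* The cut by the even number [b.-1] leaves the first entry 1, below v 0 = b. *)
  have /lexlt_head := C 0 b.-1 isT ltac:(lia) ltac:(lia) ltac:(lia).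
  by rewrite /cut v0; lia.
have [x [sx ev]] := smooth_D1P sv v0.
have xp := smooth_pos sx; have xodd := smooth_odd sx.
have Cx L : ~~ odd L -> 0 < L ->
    lexlt v (suffix_at (bstart x L) v) /\ altlt x (suffix_at L x).
  move=> oL L0.
  have lt : lexlt v (suffix_at (bstart x L) v).
    rewrite -cut0; apply: C => //; first by rewrite odd_bstart.
    by have := bstart_ge L xp; lia.
  split=> //; apply: altlt_of_D1 => //; first by move=> i; apply: xp.
  by move: lt; rewrite ev -[bstart x L]addn0 suffix_Delta_inv // (negPf oL) cut0.
case: (smooth_head sx) => x0; last first.
  split=> //; last by exists x.
  move=> k k0; rewrite {1}ev [X in suffix_at k X]ev.
  have [//|[K [oK K0 _ -> _]]] := D1_suffix_cases_b (smooth_over sx) x0 k0.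
  by rewrite -ev; case: (Cx K).
exfalso.
(* Here x = 1^b b ..., and x contains another block 1^b, preceded by b at
   position p. The block b^b of v given by x p makes C compare v = D1 x with
   D1 (1 1 1^b ...), which is smaller. *)
have xe k : ~~ odd k -> x k = 1.
  move=> ok; case: (posnP k) => [-> //|k0].
  have [_ /altlt_head] := Cx k ok k0; rewrite x0 /suffix_at addn0.
  by have := xp k; lia.
have [_ _ [y [sy y0] ex]] : lyndon_b x.
  by apply: even_one_lyndon_b => // k ok k0; case: (Cx k ok k0).
have yp := smooth_pos sy; have yodd := smooth_odd sy.
(* A longer block of b in x, starting at an odd position, would cover an even one. *)
have yo k : odd k -> y k = 1.
  move=> ok; case: (smooth_over sy k) => // yk.
  have /xe : ~~ odd (bstart y k + 1) by rewrite oddD odd_bstart ?ok.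
  by rewrite ex Delta_inv_block ?ok ?yk //; lia.
have [j [/andP[lj _]]] := smooth_change b1 1 sy; rewrite (yo 1) // => yj.
have oj : ~~ odd j by apply/negP => /yo.
have {}yj : y j = b by case: (smooth_over sy j).
case: j lj oj yj => // j _ /negPn oj yj; change (is_true (odd j)) in oj.
set p := bstart y j.
have pE : bstart y j.+1 = p.+1 by rewrite bstartS (yo j) // addn1.
have op : odd p by rewrite odd_bstart.
have xp_b : x p = b.
  have := Delta_inv_block 1 b (k := j) (j := 0) yp (yp j).
  by rewrite addn0 -ex oj.
have x1 i : i < b -> x (p.+1 + i) = 1.
  by move=> lt; rewrite ex -pE Delta_inv_block ?yj //= oj.
(* Both [bstart x p] and b - 2 are odd, so l is even as C requires; exactly one b of the block
   follows position l. *)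
pose l := bstart x p + (b - 2); pose z i := if i is i'.+1 then cut x p b.-1 i' else 1.
have vl : v l = b by rewrite ev Delta_inv_block ?op // xp_b; lia.
have zp i : 0 < z i by case: i => // i; apply: cut_pos => //; rewrite xp_b; lia.
have zE : cut v l b.-1 = D1 z.
  apply: functional_extensionality => -[|i]; first by rewrite Delta_inv0 //= vl; lia.
  have -> : D1 z i.+1 = suffix_at (bstart z 1 + 0) (D1 z) i by rewrite bstartS bstart0.
  rewrite suffix_Delta_inv // cut0 /=.
  have := @suffix_Delta_inv 1 b x p b.-1 xp; rewrite op xp_b => /(_ ltac:(lia)).
  by rewrite -ev => <-; rewrite /suffix_at /l; congr v; lia.
have : altlt x z.
  apply: altlt_of_D1 => //; rewrite -zE -ev; apply: C; rewrite ?vl; try lia.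
  by rewrite oddD odd_bstart // op; lia.
have z1 i : i <= b -> z i = 1.
  case: i => [|[|i]] lt //=; first by rewrite xp_b; lia.
  by rewrite addnS -addSn x1 //; lia.
have xb i : i <= b -> x i = if i < b then 1 else b.
  rewrite leq_eqVlt => /orP[/eqP ->|lt].
    have := Delta_inv_block 1 b (k := 1) (j := 0) yp (yp 1).
    by rewrite -ex bstartS bstart0 y0 addn0 ltnn.
  have := Delta_inv_block 1 b (k := 0) (j := i) yp.
  by rewrite -ex bstart0 y0 lt => ->.
(* The words agree before position b; there, b being odd, [altlt] would require b < 1. *)
move=> [n [e]]; case: (ltngtP n b) => lt.
- by rewrite xb ?z1 ?lt ?ltnn ?if_same // ltnW.
- by have := e b lt; rewrite xb // z1 // ltnn; lia.
- by rewrite lt ob xb // z1 // ltnn; lia.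
Qed.

Lemma lyndon_b_head w : lyndon_b w -> w 0 = 1.
Proof. by move=> [_ _ [u [su u0] ->]]; rewrite Delta_inv0 ?u0 //; lia. Qed.

(** Agreement of the preimages under F on n letters gives agreement on n + 1: [D1] gains a letter
    because the first block 1^b is longer than 1. *)
Lemma lyndon_b_unique w w' : lyndon_b w -> lyndon_b w' -> w = w'.
Proof.
move=> lw lw'; apply: functional_extensionality => k.
suff H n : forall w w', lyndon_b w -> lyndon_b w' -> forall i, i < n -> w i = w' i.
  exact: (H k.+1).
elim: n {w w' k lw lw'} => // n IH w w' /[dup] lw /lyndon_b_step [v lv ew].
move=> /[dup] lw' /lyndon_b_step [v' lv' ew'] i lt.
case: (posnP n) lt => [-> | n0 lt].
  by case: i => // _; rewrite !lyndon_b_head.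
have vp : forall i, 0 < v i by case: lv => /smooth_pos.
rewrite ew ew'; apply: (@Delta_inv_agree 1 b (Db v) (Db v') n) => //.
- by apply: Delta_inv_pos => //; lia.
- by rewrite Delta_inv0.
- by apply: eq_Delta_inv; apply: IH.
Qed.

(** A smooth word is not constant, so one starting with b has a smaller suffix starting with 1. *)
Lemma lyndon_head w : smooth b w -> lyndon w -> w 0 = 1.
Proof.
move=> sw lw; case: (smooth_head sw) => // w0; exfalso.
have [j [/andP[j0 _] wj]] := smooth_change b1 0 sw.
have := lexlt_head (lw j j0); rewrite /suffix_at addn0.
by case: (smooth_over sw j); lia.
Qed.

Lemma min_smooth_lyndon_b m : is_min_smooth b m -> lyndon_b m.
Proof.
move=> mm; have [em m0] := min_smooth_eqF mm; case: (mm) => sm _.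
split=> //; first exact: min_smooth_lyndon.
by exists (Db m) => //; split; [apply: smooth_Db|rewrite Delta_inv0 // m0].
Qed.

End Odd.

(** * Classification of the Lyndon smooth words *)

Unset Implicit Arguments.

Theorem theorem29 (b : nat) (b_gt1 : 1 < b) (b_odd : odd b) (w : word) :
  (smooth b w /\ lyndon w) <->
  (w =1 min_smooth b \/ w =1 Delta_inv1 b (min_smooth b)).
Proof.
have min_m := min_smoothP b_gt1; set m := min_smooth b in min_m *.
have lm := min_smooth_lyndon_b b_gt1 b_odd min_m; have [sm lym _] := lm.
split=> [[sw lw]|[] /functional_extensionality ->]; last first.
- split; first exact: smooth_D1.
  exact: min_smooth_D1_lyndon.
- by [].
have w0 := lyndon_head b_gt1 b_odd sw lw.
have [u [su ew]] := smooth_D1P b_gt1 b_odd sw w0; have up := smooth_pos b_odd su.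
case: (smooth_head su) => u0; last first.
  left; suff -> : w = m by [].
  by apply: (lyndon_b_unique b_gt1 b_odd) => //; split=> //; exists u.
right; suff <- : u = m by rewrite ew.
rewrite ew in lw.
(* No block of 1 in the Lyndon word w is longer than its first one, of length u 0 = 1. *)
have ue k : ~~ odd k -> u k = 1.
  move=> ok; case: (posnP k) => [-> //|k0].
  have := lyndon_D1_altlt b_gt1 b_odd (j := 0) up lw ok (up k) ltac:(lia).
  by move=> /altlt_head; rewrite cut0 /suffix_at addn0 u0; have := up k; lia.
apply: (lyndon_b_unique b_gt1 b_odd) => //.
apply: (even_one_lyndon_b b_gt1 b_odd) => // k ok k0; rewrite -cut0.
by apply: (lyndon_D1_altlt b_gt1 b_odd) => //; lia.
Qed.
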